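(* Let $G,H,K$ be finite groups, let $X$ be a left-free $(G,H)$-biset and let $Y$ be a left-free $(H,K)$-biset. Let $U\le G$ and $W\le K$, and let $\gamma\colon W\to U$ be an epimorphism. Let $\tilde\Gamma_H(U,\gamma,W)\subseteq\Gamma_H(U,\gamma,W)$ be a set of representatives of the $H$-orbits of $\Gamma_H(U,\gamma,W)$. Then the maps $X^{\lhd(U,\alpha,V)}\times_{C_H(V)}Y^{\lhd(V,\beta,W)}\to (X\times_H Y)^{\lhd(U,\gamma,W)}$, $x\times_{C_H(V)}y\mapsto x\times_H y$, induce an isomorphism of $(C_G(U),C_K(W))$-bisets $$\coprod_{(\alpha,V,\beta)\in\tilde\Gamma_H(U,\gamma,W)} X^{\lhd(U,\alpha,V)}\times_{C_H(V)}Y^{\lhd(V,\beta,W)}\ \xrightarrow{\ \sim\ }\ (X\times_H Y)^{\lhd(U,\gamma,W)}.$$ Moreover, if $\tilde\Sigma_H$ is a transversal of the $H$-conjugacy classes of subgroups of $H$, then $$|(X\times_H Y)^{\lhd(U,\gamma,W)}|=\sum_{V\le H}|H|^{-1}\sum_{\substack{(\alpha,\beta)\in E(U,V)\times E(V,W)\\ \alpha\beta=\gamma}}|X^{\lhd(U,\alpha,V)}|\cdot|Y^{\lhd(V,\beta,W)}|=\sum_{V\in\tilde\Sigma_H}|N_H(V)|^{-1}\sum_{\substack{(\alpha,\beta)\in E(U,V)\times E(V,W)\\ \alpha\beta=\gamma}}|X^{\lhd(U,\alpha,V)}|\cdot|Y^{\lhd(V,\beta,W)}|.$$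
   Context: A $(G,H)$-biset is a finite set $X$ with a left $G$-action and a right $H$-action that commute; it is identified with a left $G\times H$-set via $(g,h)x=gxh^{-1}$, and $X^L$ denotes the set of $L$-fixed points for $L\le G\times H$. It is left-free if the left $G$-action is free. For a $(G,H)$-biset $X$ and an $(H,K)$-biset $Y$, $X\times_H Y$ is the set of $H$-orbits of $X\times Y$ under $h(x,y)=(xh^{-1},hy)$; the orbit of $(x,y)$ is written $x\times_H y$, and $X\times_H Y$ is a $(G,K)$-biset via $g(x\times_H y)k=gx\times_H yk$. For groups $U,V$, $E(U,V)$ is the set of epimorphisms $\alpha\colon V\to U$. For $U\le G$, $V\le H$, $\alpha\in E(U,V)$, put $\lhd(U,\alpha,V)=\{(\alpha(v),v)\mid v\in V\}\le G\times H$ (analogously for other pairs of groups). $X^{\lhd(U,\alpha,V)}$ is a $(C_G(U),C_H(V))$-biset by restriction of the actions on $X$; similarly for $Y^{\lhd(V,\beta,W)}$ and $(X\times_HY)^{\lhd(U,\gamma,W)}$. For $U\le G$, $W\le K$ and $\gamma\in E(U,W)$, $\Gamma_H(U,\gamma,W)$ is the set of triples $(\alpha,V,\beta)$ with $V\le H$, $\alpha\in E(U,V)$, $\beta\in E(V,W)$ and $\alpha\beta=\gamma$. The group $H$ acts on it by $h(\alpha,V,\beta)=(\alpha c_h^{-1},hVh^{-1},c_h\beta)$, where $c_h$ denotes conjugation $x\mapsto hxh^{-1}$. *)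

(* Defs.v *)
From mathcomp Require Import all_boot all_order all_fingroup all_algebra.

Set Implicit Arguments.
Unset Strict Implicit.
Unset Printing Implicit Defensive.

Local Open Scope group_scope.

(* The action maps are total on the ambient types gT and hT, as is usual for   *)
(* groups G : {group gT}; only their values on G and on H are constrained.     *)
Record biset (gT hT : finGroupType) (G : {group gT}) (H : {group hT}) :=
  Biset {
    carrier :> finType;
    lact : gT -> carrier -> carrier;
    ract : carrier -> hT -> carrier;
    lact1 : forall x, lact 1 x = x;
    lactM : forall g1 g2 x, g1 \in G -> g2 \in G ->
      lact (g1 * g2) x = lact g1 (lact g2 x);
    ract1 : forall x, ract x 1 = x;
    ractM : forall h1 h2 x, h1 \in H -> h2 \in H ->
      ract x (h1 * h2) = ract (ract x h1) h2;
    lractA : forall g h x, g \in G -> h \in H ->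
      lact g (ract x h) = ract (lact g x) h }.

Definition left_free (gT hT : finGroupType) (G : {group gT}) (H : {group hT})
    (X : biset G H) : Prop :=
  forall (g : gT) (x : X), g \in G -> lact g x = x -> g = 1.

Definition biset_morph (gT hT : finGroupType) (G : {group gT}) (H : {group hT})
    (X Y : biset G H) (f : X -> Y) : Prop :=
  (forall g x, g \in G -> f (lact g x) = lact g (f x)) /\
  (forall x h, h \in H -> f (ract x h) = ract (f x) h).

Definition biset_iso (gT hT : finGroupType) (G : {group gT}) (H : {group hT})
    (X Y : biset G H) (f : X -> Y) : Prop :=
  biset_morph f /\ bijective f.

Definition pact (gT hT : finGroupType) (G : {group gT}) (H : {group hT})
    (X : biset G H) (p : gT * hT) (x : X) : X :=
  lact p.1 (ract x p.2^-1).

Definition fixpts (gT hT : finGroupType) (G : {group gT}) (H : {group hT})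
    (X : biset G H) (L : {set gT * hT}) : {set X} :=
  [set x | [forall p in L, pact p x == x]].

(* E(U, V).  A homomorphism defined on V is encoded by its extension by 1 to   *)
(* the ambient type, so that equal homomorphisms have equal encodings and      *)
(* E(U, V) is a finite set.                                                    *)
Definition Epi (gT hT : finGroupType) (U : {group gT}) (V : {group hT}) :
    {set {ffun hT -> gT}} :=
  [set a : {ffun hT -> gT} |
    [&& morphic V a, a @: V == U & [forall x, (x \notin V) ==> (a x == 1)]]].

Definition epi_comp (gT hT kT : finGroupType) (a : {ffun hT -> gT})
    (b : {ffun kT -> hT}) : {ffun kT -> gT} := [ffun w => a (b w)].

(* The subgroup written with a triangle and arguments (U, a, V); U = a(V) is   *)
(* determined by the rest.                                                     *)
Definition tri (gT hT : finGroupType) (a : {ffun hT -> gT}) (V : {group hT}) :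
    {set gT * hT} := [set (a v, v) | v in V].

Section Epi.

Variables (gT hT : finGroupType) (U : {group gT}) (V : {group hT}).

Lemma EpiP (a : {ffun hT -> gT}) :
  reflect [/\ {in V &, {morph a : x y / x * y}}, a @: V = U
            & forall x, x \notin V -> a x = 1] (a \in Epi U V).
Proof.
rewrite inE; apply: (iffP and3P) => [[/morphicP aM /eqP aV /forallP a1]|].
  by split=> // x Vx; apply/eqP/(implyP (a1 x)).
move=> [aM aV a1]; split; [exact/morphicP | exact/eqP |].
by apply/forallP=> x; apply/implyP=> Vx; rewrite a1.
Qed.

Lemma Epi_img (a : {ffun hT -> gT}) v : a \in Epi U V -> v \in V -> a v \in U.
Proof. by case/EpiP=> _ <- _; apply: imset_f. Qed.

Lemma tri_group_set (a : {ffun hT -> gT}) : a \in Epi U V -> group_set (tri a V).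
Proof.
case/EpiP=> aM _ _; apply/group_setP; split.
  apply/imsetP; exists 1 => //; congr (_, _).
  by apply: (mulgI (a 1)); rewrite -aM ?mulg1.
move=> _ _ /imsetP[v Vv ->] /imsetP[w Vw ->].
by apply/imsetP; exists (v * w); rewrite ?groupM // aM.
Qed.

End Epi.

Section FixedPoints.

Variables (gT hT : finGroupType) (G : {group gT}) (H : {group hT}).
Variables (X : biset G H) (U : {group gT}) (V : {group hT}).
Variable a : {ffun hT -> gT}.
Hypotheses (sUG : U \subset G) (sVH : V \subset H) (Ea : a \in Epi U V).

Lemma fix_triP (x : X) :
  reflect (forall v, v \in V -> lact (a v) (ract x v^-1) = x)
          (x \in fixpts X (tri a V)).
Proof.
rewrite inE; apply: (iffP forall_inP) => [fx v Vv | fx _ /imsetP[v Vv ->]].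
  exact: (eqP (fx (a v, v) (imset_f _ Vv))).
by apply/eqP/fx.
Qed.

Lemma fix_tri_lact g (x : X) : g \in 'C_G(U) -> x \in fixpts X (tri a V) ->
  lact g x \in fixpts X (tri a V).
Proof.
case/setIP=> Gg /centP cg /fix_triP fx; apply/fix_triP=> v Vv.
have Uav := Epi_img Ea Vv; have Gav := subsetP sUG _ Uav.
have Hv : v^-1 \in H by rewrite groupV (subsetP sVH).
by rewrite -lractA // -lactM // -(cg _ Uav) lactM // fx.
Qed.

Lemma fix_tri_ract h (x : X) : h \in 'C_H(V) -> x \in fixpts X (tri a V) ->
  ract x h \in fixpts X (tri a V).
Proof.
case/setIP=> Hh /centP ch /fix_triP fx; apply/fix_triP=> v Vv.
have Gav := subsetP sUG _ (Epi_img Ea Vv).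
have Hv : v^-1 \in H by rewrite groupV (subsetP sVH).
have chv : h * v^-1 = v^-1 * h by apply: ch; rewrite groupV.
by rewrite -ractM // chv ractM // lractA // fx.
Qed.

Definition fix_lact g (x : {x : X | x \in fixpts X (tri a V)}) :
  {x : X | x \in fixpts X (tri a V)} := insubd x (lact g (val x)).

Definition fix_ract (x : {x : X | x \in fixpts X (tri a V)}) h :
  {x : X | x \in fixpts X (tri a V)} := insubd x (ract (val x) h).

Lemma val_fix_lact g x : g \in 'C_G(U) -> val (fix_lact g x) = lact g (val x).
Proof. by move=> Cg; rewrite val_insubd fix_tri_lact ?(valP x). Qed.

Lemma val_fix_ract x h : h \in 'C_H(V) -> val (fix_ract x h) = ract (val x) h.
Proof. by move=> Ch; rewrite val_insubd fix_tri_ract ?(valP x). Qed.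

Lemma fix_lact1 x : fix_lact 1 x = x.
Proof. by apply: val_inj; rewrite val_fix_lact ?group1 // lact1. Qed.

Lemma fix_lactM g1 g2 x : g1 \in 'C_G(U) -> g2 \in 'C_G(U) ->
  fix_lact (g1 * g2) x = fix_lact g1 (fix_lact g2 x).
Proof.
move=> C1 C2; apply: val_inj; rewrite !val_fix_lact ?groupM //.
by case/setIP: C1 => *; case/setIP: C2 => *; apply: lactM.
Qed.

Lemma fix_ract1 x : fix_ract x 1 = x.
Proof. by apply: val_inj; rewrite val_fix_ract ?group1 // ract1. Qed.

Lemma fix_ractM h1 h2 x : h1 \in 'C_H(V) -> h2 \in 'C_H(V) ->
  fix_ract x (h1 * h2) = fix_ract (fix_ract x h1) h2.
Proof.
move=> C1 C2; apply: val_inj; rewrite !val_fix_ract ?groupM //.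
by case/setIP: C1 => *; case/setIP: C2 => *; apply: ractM.
Qed.

Lemma fix_lractA g h x : g \in 'C_G(U) -> h \in 'C_H(V) ->
  fix_lact g (fix_ract x h) = fix_ract (fix_lact g x) h.
Proof.
move=> Cg Ch; apply: val_inj.
rewrite val_fix_lact // !val_fix_ract // val_fix_lact //.
by case/setIP: Cg => *; case/setIP: Ch => *; apply: lractA.
Qed.

Definition fix_biset : biset 'C_G(U)%G 'C_H(V)%G :=
  Biset fix_lact1 fix_lactM fix_ract1 fix_ractM fix_lractA.

End FixedPoints.

Section Tensor.

Variables (gT hT kT : finGroupType).
Variables (G : {group gT}) (H : {group hT}) (K : {group kT}).
Variables (X : biset G H) (Y : biset H K).

Definition torbit (p : X * Y) : {set X * Y} :=
  [set (ract p.1 h^-1, lact h p.2) | h in H].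

Definition tensor_sort := {A : {set X * Y} | A \in [set torbit p | p in setT]}.

Definition tens (x : X) (y : Y) : tensor_sort :=
  exist _ (torbit (x, y)) (imset_f torbit (in_setT (x, y))).

Lemma tensor_exP (A : tensor_sort) : exists p, val A == torbit p.
Proof. by case: A => _ /= /imsetP[p _ ->]; exists p. Qed.

Definition trepr (A : tensor_sort) : X * Y := xchoose (tensor_exP A).

Lemma treprK A : tens (trepr A).1 (trepr A).2 = A.
Proof.
apply: val_inj; rewrite /= -surjective_pairing.
by rewrite -(eqP (xchooseP (tensor_exP A))).
Qed.

Lemma tens_move x y h : h \in H -> tens (ract x h^-1) (lact h y) = tens x y.
Proof.
move=> Hh; apply: val_inj; apply/setP=> q; apply/imsetP/imsetP=> -[k Hk ->] /=.
  by exists (k * h); rewrite ?groupM // invMg ractM ?groupV // lactM.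
exists (k * h^-1); first by rewrite groupM ?groupV.
by rewrite -ractM ?groupV ?groupM ?groupV // -lactM ?groupM ?groupV //
  invMg invgK mulKg mulgKV.
Qed.

Lemma tens_eqP x y x' y' :
  tens x y = tens x' y' <->
  exists2 h, h \in H & (x' = ract x h^-1) /\ (y' = lact h y).
Proof.
split=> [/(congr1 val) /= eqt | [h Hh [-> ->]]]; last by rewrite tens_move.
have: (x', y') \in torbit (x', y').
  by apply/imsetP; exists 1; rewrite ?group1 //= invg1 ract1 lact1.
by rewrite -eqt => /imsetP[h Hh [-> ->]]; exists h.
Qed.

(* Both actions are defined on a chosen element of each orbit; tens_lact and   *)
(* tens_ract show that the choice is irrelevant.                               *)
Definition tensor_lact g (A : tensor_sort) : tensor_sort :=
  tens (lact g (trepr A).1) (trepr A).2.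

Definition tensor_ract (A : tensor_sort) k : tensor_sort :=
  tens (trepr A).1 (ract (trepr A).2 k).

Lemma tens_lact g x y : g \in G -> tensor_lact g (tens x y) = tens (lact g x) y.
Proof.
move=> Gg; rewrite /tensor_lact; have /esym/tens_eqP := treprK (tens x y).
case=> h Hh [-> ->].
by rewrite lractA ?groupV // tens_move.
Qed.

Lemma tens_ract x y k : k \in K -> tensor_ract (tens x y) k = tens x (ract y k).
Proof.
move=> Kk; rewrite /tensor_ract; have /esym/tens_eqP := treprK (tens x y).
case=> h Hh [-> ->].
by rewrite -lractA // tens_move.
Qed.

Lemma tensor_lact1 A : tensor_lact 1 A = A.
Proof. by rewrite /tensor_lact lact1 treprK. Qed.

Lemma tensor_lactM g1 g2 A : g1 \in G -> g2 \in G ->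
  tensor_lact (g1 * g2) A = tensor_lact g1 (tensor_lact g2 A).
Proof. by move=> *; rewrite -(treprK A) !tens_lact ?groupM // lactM. Qed.

Lemma tensor_ract1 A : tensor_ract A 1 = A.
Proof. by rewrite /tensor_ract ract1 treprK. Qed.

Lemma tensor_ractM k1 k2 A : k1 \in K -> k2 \in K ->
  tensor_ract A (k1 * k2) = tensor_ract (tensor_ract A k1) k2.
Proof. by move=> *; rewrite -(treprK A) !tens_ract ?groupM // ractM. Qed.

Lemma tensor_lractA g k A : g \in G -> k \in K ->
  tensor_lact g (tensor_ract A k) = tensor_ract (tensor_lact g A) k.
Proof. by move=> *; rewrite -(treprK A) !(tens_ract, tens_lact). Qed.

Definition tensor : biset G K :=
  Biset tensor_lact1 tensor_lactM tensor_ract1 tensor_ractM tensor_lractA.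

End Tensor.

Section Coproduct.

Variables (gT hT : finGroupType) (G : {group gT}) (H : {group hT}).
Variables (I : finType) (X : I -> biset G H).

Let T : finType := {i : I & X i}.

Definition coprod_lact g (u : T) : T := Tagged X (lact g (tagged u)).

Definition coprod_ract (u : T) h : T := Tagged X (ract (tagged u) h).

Lemma coprod_lact1 u : coprod_lact 1 u = u.
Proof. by case: u => i x; rewrite /coprod_lact /= lact1. Qed.

Lemma coprod_lactM g1 g2 u : g1 \in G -> g2 \in G ->
  coprod_lact (g1 * g2) u = coprod_lact g1 (coprod_lact g2 u).
Proof. by move=> *; rewrite /coprod_lact /= lactM. Qed.

Lemma coprod_ract1 u : coprod_ract u 1 = u.
Proof. by case: u => i x; rewrite /coprod_ract /= ract1. Qed.

Lemma coprod_ractM h1 h2 u : h1 \in H -> h2 \in H ->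
  coprod_ract u (h1 * h2) = coprod_ract (coprod_ract u h1) h2.
Proof. by move=> *; rewrite /coprod_ract /= ractM. Qed.

Lemma coprod_lractA g h u : g \in G -> h \in H ->
  coprod_lact g (coprod_ract u h) = coprod_ract (coprod_lact g u) h.
Proof. by move=> *; rewrite /coprod_ract /coprod_lact /= lractA. Qed.

Definition coprod : biset G H :=
  Biset coprod_lact1 coprod_lactM coprod_ract1 coprod_ractM coprod_lractA.

Definition coprod_in (i : I) (x : X i) : coprod := Tagged X x.

End Coproduct.

Notation triple gT hT kT :=
  ({ffun hT -> gT} * {group hT} * {ffun kT -> hT})%type.

Section Gamma.

Variables (gT hT kT : finGroupType).
Variables (G : {group gT}) (H : {group hT}) (K : {group kT}).

Definition Gamma (U : {group gT}) (c : {ffun kT -> gT}) (W : {group kT}) :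
    {set triple gT hT kT} :=
  [set t : triple gT hT kT |
    [&& t.1.2 \subset H, t.1.1 \in Epi U t.1.2,
        t.2 \in Epi t.1.2 W & epi_comp t.1.1 t.2 == c]].

(* Left action (a, V, b) |-> (a c_h^-1, hVh^-1, c_h b); in MathComp x ^ h is   *)
(* h^-1 * x * h, that is c_h^-1 (x).                                           *)
Definition Gamma_act (h : hT) (t : triple gT hT kT) : triple gT hT kT :=
  ([ffun x => t.1.1 (x ^ h)], (t.1.2 :^ h^-1)%G, [ffun w => t.2 w ^ h^-1]).

Definition Gamma_orbit (t : triple gT hT kT) : {set triple gT hT kT} :=
  [set Gamma_act h t | h in H].

Variables (U : {group gT}) (W : {group kT}) (c : {ffun kT -> gT}).

Lemma Gamma_act1 t : Gamma_act 1 t = t.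
Proof.
case: t => [[a V] b]; congr (_, _, _).
- by apply/ffunP=> x; rewrite ffunE conjg1.
- by apply: val_inj; rewrite /= invg1 conjsg1.
- by apply/ffunP=> x; rewrite ffunE invg1 conjg1.
Qed.

Lemma Gamma_actM h1 h2 t : Gamma_act (h1 * h2) t = Gamma_act h1 (Gamma_act h2 t).
Proof.
case: t => [[a V] b]; congr (_, _, _).
- by apply/ffunP=> x; rewrite !ffunE conjgM.
- by apply: val_inj; rewrite /= invMg conjsgM.
- by apply/ffunP=> x; rewrite !ffunE invMg conjgM.
Qed.

Lemma GammaP (t : triple gT hT kT) :
  reflect [/\ t.1.2 \subset H, t.1.1 \in Epi U t.1.2, t.2 \in Epi t.1.2 W
            & epi_comp t.1.1 t.2 = c] (t \in Gamma U c W).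
Proof.
rewrite [_ \in Gamma _ _ _]in_set.
by apply: (iffP and4P) => -[? ? ? /eqP]; split.
Qed.

Lemma Gamma_act_stable h t :
  h \in H -> t \in Gamma U c W -> Gamma_act h t \in Gamma U c W.
Proof.
case: t => [[a V] b] Hh /GammaP[/= sVH /EpiP[aM aV a1] /EpiP[bM bW b1] abc].
apply/GammaP; split=> /=.
- by rewrite -(conjGid (groupVr Hh)) conjSg.
- apply/EpiP; split=> [x y | | x] /=; rewrite ?mem_conjgV.
  + by move=> Vx Vy; rewrite !ffunE conjMg aM.
  + rewrite -aV; apply/setP=> u; apply/imsetP/imsetP=> -[v Vv ->].
      by exists (v ^ h); rewrite ?ffunE // -mem_conjgV.
    by exists (v ^ h^-1); rewrite ?ffunE ?conjgKV // memJ_conjg.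
  + by move=> Vx; rewrite ffunE a1.
- apply/EpiP; split=> [x y | | x] /=.
  + by move=> Wx Wy; rewrite !ffunE bM // conjMg.
  + rewrite -bW; apply/setP=> u; apply/imsetP/imsetP=> -[v Vv ->].
      by exists (b v); rewrite ?ffunE ?imset_f.
    by case/imsetP: Vv => w Ww ->; exists w; rewrite ?ffunE.
  + by move=> Wx; rewrite ffunE b1 // conj1g.
- by rewrite -abc; apply/ffunP=> w; rewrite !ffunE conjgKV.
Qed.

Lemma Gamma_orbit_partition :
  partition [set Gamma_orbit t | t in Gamma U c W] (Gamma U c W).
Proof.
have self t : t \in Gamma_orbit t.
  by apply/imsetP; exists 1; rewrite ?group1 ?Gamma_act1.
have orbE s t : s \in Gamma_orbit t -> Gamma_orbit s = Gamma_orbit t.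
  case/imsetP=> h Hh ->; apply/setP=> u; apply/imsetP/imsetP=> -[k Hk ->].
    by exists (k * h); rewrite ?groupM ?Gamma_actM.
  exists (k * h^-1); first by rewrite groupM ?groupV.
  by rewrite -Gamma_actM mulgKV.
apply/and3P; split.
- apply/eqP/setP=> t; apply/bigcupP/idP=> [[_ /imsetP[s Gs ->]] | Gt].
    by case/imsetP=> h Hh ->; apply: Gamma_act_stable.
  by exists (Gamma_orbit t); rewrite ?imset_f.
- apply/trivIsetP=> _ _ /imsetP[s _ ->] /imsetP[t _ ->]; apply: contraR.
  by case/pred0Pn=> u /andP[/orbE <- /orbE <-].
- by apply/imsetP=> -[t _ /setP/(_ t)]; rewrite self inE.
Qed.

Lemma Gamma_sub t : t \in Gamma U c W -> t.1.2 \subset H.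
Proof. by case/GammaP. Qed.

Lemma Gamma_epil t : t \in Gamma U c W -> t.1.1 \in Epi U t.1.2.
Proof. by case/GammaP. Qed.

Lemma Gamma_epir t : t \in Gamma U c W -> t.2 \in Epi t.1.2 W.
Proof. by case/GammaP. Qed.

Variables (X : biset G H) (Y : biset H K).
Hypotheses (sUG : U \subset G) (sWK : W \subset K).

Section Summand.

Variables (t : triple gT hT kT) (Gt : t \in Gamma U c W).

Definition fixl : biset 'C_G(U)%G 'C_H(t.1.2)%G :=
  fix_biset X sUG (Gamma_sub Gt) (Gamma_epil Gt).

Definition fixr : biset 'C_H(t.1.2)%G 'C_K(W)%G :=
  fix_biset Y (Gamma_sub Gt) sWK (Gamma_epir Gt).

End Summand.

Variables (S : {set triple gT hT kT}) (sSG : S \subset Gamma U c W).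

Definition Gamma_summand (t : {t : triple gT hT kT | t \in S}) :
    biset 'C_G(U)%G 'C_K(W)%G :=
  tensor (fixl (subsetP sSG _ (valP t))) (fixr (subsetP sSG _ (valP t))).

Definition Gamma_coprod : biset 'C_G(U)%G 'C_K(W)%G := coprod Gamma_summand.

Definition Gamma_in (t : {t : triple gT hT kT | t \in S})
    (x : fixl (subsetP sSG _ (valP t))) (y : fixr (subsetP sSG _ (valP t))) :
    Gamma_coprod :=
  coprod_in (X := Gamma_summand) (tens x y).

Definition epi_pairs (V : {group hT}) :
    {set {ffun hT -> gT} * {ffun kT -> hT}} :=
  [set p : {ffun hT -> gT} * {ffun kT -> hT} |
    [&& p.1 \in Epi U V, p.2 \in Epi V W & epi_comp p.1 p.2 == c]].

End Gamma.

(* Main.v *)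
(* A point of the tensor product over H represented by (x, y) is fixed by the  *)
(* subgroup attached to (U, gamma, W) if and only if (x, y) is fixed on both   *)
(* sides by some triple (a, V, b) of Gamma: b w is the unique h in H with      *)
(* h y = y w, V is the image of b, and a v is the unique g in G with g x = x v *)
(* (freeness gives uniqueness).  So the pairs with a fixed class are the       *)
(* disjoint union over Gamma of the products of fixed points, H acts freely    *)
(* on them, compatibly with its action on Gamma, and the stabilizer of         *)
(* (a, V, b) is C_H(V); counting the pairs gives the cardinality formulas.     *)
Require Import Defs.
From mathcomp Require Import all_boot all_order all_fingroup all_algebra.

Set Implicit Arguments.
Unset Strict Implicit.
Unset Printing Implicit Defensive.

Import GRing.Theory Num.Theory.

Local Open Scope group_scope.

(* The library's [ract], the restriction of an action, shadows that of Defs. *)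
Local Notation ract := Defs.ract.

(** Call a pair (x, y) fixed if its class in the tensor product is. By [tens_fix],
    [fix_pairs_exists] and [fix_pairs_inj] the fixed pairs are the disjoint union of the sets
    [fix_pairs t] over Gamma, and by [pair_act_fix] H permutes these sets as it permutes Gamma.
    Isomorphism: a fixed class is an H-orbit of pairs, and its triples form one H-orbit of Gamma, so
    it meets [fix_pairs t] for exactly one t = (a, V, b) in S. Two of its pairs over this t differ
    by some h stabilizing t; then h centralizes b(W) = V, so they agree over C_H(V). Counting: H
    acts freely on pairs because Y is left-free, so there are |H| fixed pairs per fixed class
    ([card_fixed_pairs]). Grouping Gamma by V gives the first sum; the share of V is invariant under
    conjugation ([fiberJ]), and orbit-stabilizer gives the second. *)

Lemma left_free_inj (gT hT : finGroupType) (G : {group gT}) (H : {group hT})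
    (X : biset G H) (x : X) :
  left_free X -> {in G &, injective (fun g => lact g x)}.
Proof.
move=> freeX g g' Gg Gg' eqgx; apply/esym/eqP; rewrite eq_mulVg1; apply/eqP.
apply: (freeX _ x); first by rewrite groupM ?groupV.
by rewrite lactM ?groupV // eqgx -lactM ?groupV // mulVg lact1.
Qed.

Lemma fix_tri_eqP (gT hT : finGroupType) (G : {group gT}) (H : {group hT})
    (X : biset G H) (U : {group gT}) (V : {group hT}) (a : {ffun hT -> gT})
    (x : X) : U \subset G -> V \subset H -> a \in Epi U V ->
  reflect {in V, forall v, lact (a v) x = ract x v} (x \in fixpts X (tri a V)).
Proof.
move=> sUG sVH Ea; apply: (iffP (fix_triP V a x)) => fx v Vv;
  have Gav := subsetP sUG _ (Epi_img Ea Vv); have Hv := subsetP sVH _ Vv.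
  by rewrite -{2}(fx v Vv) -lractA ?groupV // -ractM ?groupV // mulVg ract1.
by rewrite lractA ?groupV // fx // -ractM ?groupV // mulgV ract1.
Qed.

(** Serves to collapse the sum over all subgroups of H to class representatives. *)
Lemma sum_transversal (R : nmodType) (T : finType) (P : {set {set T}})
    (D S : {set T}) (F : T -> R) : is_transversal S P D ->
  (\sum_(x in D) F x = \sum_(x in S) \sum_(y in pblock P x) F y)%R.
Proof.
move=> trS; have [partP _ _] := and3P trS.
rewrite (set_partition_big _ partP) -[in LHS](pblock_transversal trS) /=.
by rewrite [LHS](big_imset _ (pblock_inj trS)).
Qed.

(** * Pairs fixed by a triple of Gamma *)

Section TensorFixedPoints.

Variables (gT hT kT : finGroupType).
Variables (G : {group gT}) (H : {group hT}) (K : {group kT}).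
Variables (X : biset G H) (Y : biset H K).
Hypotheses (freeX : left_free X) (freeY : left_free Y).
Variables (U : {group gT}) (W : {group kT}) (c : {ffun kT -> gT}).
Hypotheses (sUG : U \subset G) (sWK : W \subset K) (Ec : c \in Epi U W).

Let tT := ({ffun hT -> gT} * {group hT} * {ffun kT -> hT})%type.
Implicit Types (t : tT) (p : X * Y).

Definition fix_pairs t : {set X * Y} :=
  setX (fixpts X (tri t.1.1 t.1.2)) (fixpts Y (tri t.2 W)).

(** The H-action whose orbits are the points of the tensor product. *)
Definition pair_act h p : X * Y := (ract p.1 h^-1, lact h p.2).

Lemma fix_pairsP t p : t \in Gamma H U c W ->
  reflect ({in t.1.2, forall v, lact (t.1.1 v) p.1 = ract p.1 v} /\
           {in W, forall w, lact (t.2 w) p.2 = ract p.2 w})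
          (p \in fix_pairs t).
Proof.
case: p => x y /GammaP[sVH Ea Eb _]; rewrite in_setX /=.
have Px := fix_tri_eqP x sUG sVH Ea; have Py := fix_tri_eqP y sVH sWK Eb.
by apply: (iffP andP) => -[/Px ? /Py ?]; split.
Qed.

Lemma pair_act_fix h t p : h \in H -> t \in Gamma H U c W ->
  p \in fix_pairs t -> pair_act h p \in fix_pairs (Gamma_act h t).
Proof.
move=> Hh Gt /(fix_pairsP _ Gt)[fx fy].
have [sVH Ea Eb _] := GammaP _ _ _ _ _ Gt.
apply/(fix_pairsP _ (Gamma_act_stable Hh Gt)); split=> [v | w Ww] /=;
  rewrite ffunE.
  rewrite mem_conjgV => Vv; have Gav := subsetP sUG _ (Epi_img Ea Vv).
  have Hv : v \in H by rewrite -(groupJr v Hh) (subsetP sVH).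
  rewrite lractA ?groupV // fx // -!ractM ?groupV ?groupJ //.
  by rewrite conjgE -mulgA mulgK.
have Hbw := subsetP sVH _ (Epi_img Eb Ww); have Kw := subsetP sWK _ Ww.
rewrite -lactM ?groupJ ?groupV // conjgE invgK mulgA mulgKV lactM // fy //.
by rewrite lractA.
Qed.

Lemma pair_act_inj h : h \in H -> injective (pair_act h).
Proof.
move=> Hh [x y] [x' y'] [/(congr1 (fun z => ract z h)) + /(congr1 (lact h^-1))].
by rewrite -!ractM -?lactM ?groupV // mulVg !ract1 !lact1 => -> ->.
Qed.

(** Injectivity of [pair_act] gives one inequality for h and the other for its inverse. *)
Lemma card_fix_pairs_act h t : h \in H -> t \in Gamma H U c W ->
  #|fix_pairs (Gamma_act h t)| = #|fix_pairs t|.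
Proof.
have le k s : k \in H -> s \in Gamma H U c W ->
    #|fix_pairs s| <= #|fix_pairs (Gamma_act k s)|.
  move=> Hk Gs; rewrite -(card_imset _ (pair_act_inj Hk)).
  apply/subset_leq_card/subsetP=> _ /imsetP[p sp ->]; exact: pair_act_fix.
move=> Hh Gt; apply/eqP; rewrite eqn_leq le // andbT.
have := le h^-1 (Gamma_act h t); rewrite -Gamma_actM mulVg Gamma_act1; apply.
  by rewrite groupV.
exact: Gamma_act_stable.
Qed.

(** Freeness of Y recovers b from p.2, then V = b(W), and freeness of X recovers a from p.1; outside
    their domains both maps are 1. *)
Lemma fix_pairs_inj t t' p : t \in Gamma H U c W -> t' \in Gamma H U c W ->
  p \in fix_pairs t -> p \in fix_pairs t' -> t = t'.
Proof.
case: t t' => [[a V] b] [[a' V'] b'] Gt Gt'.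
move=> /(fix_pairsP _ Gt)[/= fx fy] /(fix_pairsP _ Gt')[/= fx' fy'].
have [/= sVH /[dup] Ea /EpiP[_ _ a1] /[dup] Eb /EpiP[_ bW b1] _] :=
  GammaP _ _ _ _ _ Gt.
have [/= sVH' /[dup] Ea' /EpiP[_ _ a1'] /[dup] Eb' /EpiP[_ bW' b1'] _] :=
  GammaP _ _ _ _ _ Gt'.
have eqb : b = b'.
  apply/ffunP=> w; have [Ww | /[dup]/b1 -> /b1' -> //] := boolP (w \in W).
  apply: (left_free_inj (x := p.2) freeY)
    (subsetP sVH _ (Epi_img Eb Ww))
    (subsetP sVH' _ (Epi_img Eb' Ww)) _.
  by rewrite /= fy // fy'.
have eqV : V = V' by apply: val_inj; rewrite /= -bW -bW' eqb.
congr (_, _, _) => //; apply/ffunP=> v.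
have [Vv | /[dup] nVv /a1 ->] := boolP (v \in V); last by rewrite a1' -?eqV.
have Vv' : v \in V' by rewrite -eqV.
apply: (left_free_inj (x := p.1) freeX)
  (subsetP sUG _ (Epi_img Ea Vv))
  (subsetP sUG _ (Epi_img Ea' Vv')) _.
by rewrite /= fx // fx'.
Qed.

(** Pass b w across the tensor sign: c(w)x and y give the class of x b(w) and y, that is of x and
    b(w)y = y w. *)
Lemma tens_fix t p : t \in Gamma H U c W -> p \in fix_pairs t ->
  tens p.1 p.2 \in fixpts (tensor X Y) (tri c W).
Proof.
move=> Gt /(fix_pairsP _ Gt)[fx fy]; have [sVH Ea Eb cE] := GammaP _ _ _ _ _ Gt.
apply/(fix_tri_eqP _ sUG sWK Ec) => w Ww.
have Vbw := Epi_img Eb Ww; have Hbw := subsetP sVH _ Vbw.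
rewrite -cE ffunE /= tens_ract ?(subsetP sWK) // tens_lact; last first.
  by rewrite (subsetP sUG) // (Epi_img Ea).
by rewrite fx // -fy // -[tens _ (lact _ _)](tens_move _ _ (groupVr Hbw)) invgK
  -lactM ?groupV // mulVg lact1.
Qed.

Lemma fix_pairs_exists p : tens p.1 p.2 \in fixpts (tensor X Y) (tri c W) ->
  exists2 t, t \in Gamma H U c W & p \in fix_pairs t.
Proof.
case: p => x y /(fix_tri_eqP _ sUG sWK Ec) /= fxy.
have [cM cW c1] := EpiP _ _ _ Ec.
(* On W the default 1 is never taken: comparing the classes of (c(w)x, y) and (x, y w) produces the
   required h, as [bP] records. Off W the value 1 is forced by the encoding of [Epi]. *)
pose b := [ffun w =>
  if w \in W then odflt 1 [pick h in H | lact h y == ract y w] else 1].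
have bP w : w \in W ->
    [/\ b w \in H, lact (b w) y = ract y w & lact (c w) x = ract x (b w)].
  move=> Ww; have Gcw := subsetP sUG _ (Epi_img Ec Ww).
  have := fxy w Ww; rewrite tens_lact // tens_ract ?(subsetP sWK) //.
  case/tens_eqP=> h Hh [xE yE]; have -> : b w = h.
    rewrite ffunE Ww; case: pickP => [k /andP[Hk /eqP kE] /= | /(_ h)].
      by apply: (left_free_inj (x := y) freeY) Hk Hh _; rewrite /= kE.
    by rewrite Hh -yE eqxx.
  by split; rewrite // [in RHS]xE -ractM ?groupV // mulVg ract1.
(* Both b(u v) and b(u) b(v) send y to y u v, so freeness of Y identifies them. *)
have bM : {in W &, {morph b : u v / u * v}}.
  move=> u v Wu Wv; have [[Hu yu _] [Hv yv _]] := (bP u Wu, bP v Wv).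
  have [Huv yuv _] := bP _ (groupM Wu Wv).
  have [Ku Kv] := (subsetP sWK _ Wu, subsetP sWK _ Wv).
  apply: (left_free_inj (x := y) freeY) Huv (groupM Hu Hv) _ => /=.
  by rewrite yuv ractM // -yu -lractA // -yv lactM.
have b1 : b 1 = 1 by apply: (mulgI (b 1)); rewrite -bM ?mulg1.
have gV : group_set (b @: W).
  apply/group_setP; split; first by apply/imsetP; exists 1.
  move=> _ _ /imsetP[u Wu ->] /imsetP[v Wv ->].
  by rewrite -bM // imset_f ?groupM.
(* Choosing a v from x, rather than through a preimage of v under b, makes it well defined at once;
   [ab] holds because c w satisfies the condition defining a (b w). *)
pose a := [ffun v =>
  if v \in Group gV then odflt 1 [pick g in G | lact g x == ract x v] else 1].
have ab w : w \in W -> a (b w) = c w.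
  move=> Ww; have [Hbw _ xw] := bP w Ww.
  have Gcw := subsetP sUG _ (Epi_img Ec Ww).
  rewrite ffunE imset_f //; case: pickP
    => [g /andP[Gg /eqP gE] /= | /(_ (c w))].
    by apply: (left_free_inj (x := x) freeX) Gg Gcw _; rewrite /= gE.
  by rewrite Gcw xw eqxx.
have Gt : (a, Group gV, b) \in Gamma H U c W.
  apply/GammaP; split=> /=.
  - by apply/subsetP=> _ /imsetP[w /bP[Hbw _ _] ->].
  - apply/EpiP; split=> [_ _ /imsetP[u Wu ->] /imsetP[v Wv ->] | | v nVv].
    + by rewrite -bM // !ab ?groupM // cM.
    + rewrite -cW -imset_comp; apply: eq_in_imset => w Ww; exact: ab.
    + by rewrite ffunE (negPf nVv).
  - by apply/EpiP; split=> // w nWw; rewrite ffunE (negPf nWw).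
  - apply/ffunP=> w; rewrite ffunE; have [/ab // | nWw] := boolP (w \in W).
    (* Off W, b w = 1 = b 1, so a (b w) = c 1 = 1. *)
    rewrite c1 // [b w]ffunE (negPf nWw) -b1 ab ?group1 //.
    by apply: (mulgI (c 1)); rewrite -cM ?mulg1.
exists (a, Group gV, b) => //; apply/(fix_pairsP _ Gt); split=> /=.
  by move=> _ /imsetP[w Ww ->]; rewrite ab //; case: (bP w Ww).
by move=> w /bP[].
Qed.

(** * Counting fixed pairs *)

Let fixed_pairs : {set X * Y} :=
  [set p | tens p.1 p.2 \in fixpts (tensor X Y) (tri c W)].

Lemma card_fixed_pairs :
  #|fixed_pairs| = (#|fixpts (tensor X Y) (tri c W)| * #|H|)%N.
Proof.
rewrite -sum1_card (partition_big (fun p => tens p.1 p.2)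
  [in fixpts (tensor X Y) (tri c W)]) /= => [|p]; last by rewrite inE.
rewrite -sum_nat_const; apply: eq_bigr => A fA.
have [[x y] eA] : exists p, tens p.1 p.2 = A by exists (trepr A); exact: treprK.
rewrite -(card_in_imset (f := fun h => pair_act h (x, y)) (D := H)); last first.
  move=> h k Hh Hk [_]; exact: (left_free_inj (x := y) freeY).
rewrite sum1dep_card; apply: eq_card => q; rewrite !inE.
apply/andP/imsetP=> [[_ /eqP] | [h Hh ->]]; rewrite -eA.
  move/esym; case: q => x' y' /tens_eqP[h Hh [/= -> ->]]; by exists h.
by move: fA; rewrite inE -eA /= tens_move // => ->.
Qed.

Lemma sum_card_fix_pairs :
  (\sum_(t in Gamma H U c W) #|fix_pairs t| = #|fixed_pairs|)%N.
Proof.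
rewrite -[RHS]sum1_card.
under eq_bigr => t _ do rewrite -sum1_card.
rewrite (exchange_big_dep [in fixed_pairs]) /= => [|t p Gt tp]; last first.
  by rewrite inE (tens_fix Gt).
apply: eq_bigr => p; rewrite inE => /fix_pairs_exists[t Gt tp].
rewrite (big_pred1 t) // => s; apply/andP/eqP=> [[Gs sp] | -> //].
exact: fix_pairs_inj Gs Gt sp tp.
Qed.

Definition fiber (V : {group hT}) : nat :=
  \sum_(t in Gamma H U c W | t.1.2 == V) #|fix_pairs t|.

Lemma sum_fiber : \sum_(V in subgroups H) fiber V = #|fixed_pairs|.
Proof.
rewrite -sum_card_fix_pairs; apply/esym/partition_big => t Gt.
by rewrite inE (Gamma_sub Gt).
Qed.

(** The action of h^-1 maps the triples over V bijectively to those over V :^ h and preserves the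
    number of fixed pairs. *)
Lemma fiberJ (V : {group hT}) h : h \in H -> fiber (V :^ h)%G = fiber V.
Proof.
move=> Hh; have Hh' := groupVr Hh.
rewrite /fiber (reindex_onto (Gamma_act h^-1) (Gamma_act h)) => [|t _]; last first.
  by rewrite -Gamma_actM mulVg Gamma_act1.
apply: eq_big => [t | t /andP[/andP[Gt _] /eqP tE]].
  rewrite -Gamma_actM mulgV Gamma_act1 eqxx andbT; apply/andP/andP => -[Gt].
    rewrite -(Gamma_act1 t) -(mulgV h) Gamma_actM (Gamma_act_stable Hh Gt) /=.
    move=> /eqP/(congr1 val); rewrite /= invgK => /conjsg_inj eqV; split=> //.
    exact/eqP/val_inj.
  move/eqP <-; rewrite Gamma_act_stable //; split=> //=.
  by apply/eqP/val_inj; rewrite /= invgK.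
by rewrite card_fix_pairs_act // -tE Gamma_act_stable.
Qed.

Lemma sum_epi_pairs (V : {group hT}) : V \subset H ->
  fiber V = \sum_(p in epi_pairs U W c V)
    #|fixpts X (tri p.1 V)| * #|fixpts Y (tri p.2 W)|.
Proof.
move=> sVH; rewrite /fiber.
rewrite (reindex_onto (fun q => (q.1, V, q.2)) (fun t : tT => (t.1.1, t.2))) /=.
  apply: eq_big => [[a b] | q _]; last by rewrite cardsX.
  by rewrite !inE /= sVH !eqxx !andbT.
by case=> [[a V'] b] /= /andP[_ /eqP ->].
Qed.

(** * The isomorphism of bisets *)

Variables (S : {set tT}) (sSG : S \subset Gamma H U c W).

Section Summand.

Variable t : {t : tT | t \in S}.
Let Gt : val t \in Gamma H U c W := subsetP sSG _ (valP t).

(** Uses a chosen representative of a C_H(V)-orbit; [tens_valE] shows that the choice is irrelevant,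
    as C_H(V) lies in H. *)
Definition tens_val (A : Gamma_summand X Y sUG sWK sSG t) : tensor X Y :=
  tens (val (trepr A).1) (val (trepr A).2).

Lemma tens_valE (x : fixl X sUG Gt) (y : fixr Y sWK Gt) :
  tens_val (tens x y) = tens (val x) (val y).
Proof.
rewrite /tens_val; have /esym/tens_eqP[h Ch [-> ->]] := treprK (tens x y).
rewrite (val_fix_ract sUG (Gamma_sub Gt) (Gamma_epil Gt)) ?groupV //.
rewrite (val_fix_lact (Gamma_sub Gt) sWK (Gamma_epir Gt)) // tens_move //.
by case/setIP: Ch.
Qed.

Lemma val_fix_pairs (x : fixl X sUG Gt) (y : fixr Y sWK Gt) :
  (val x, val y) \in fix_pairs (val t).
Proof. by rewrite in_setX (valP x) (valP y). Qed.

Lemma tens_val_fix A : tens_val A \in fixpts (tensor X Y) (tri c W).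
Proof. exact: (tens_fix Gt (val_fix_pairs (trepr A).1 (trepr A).2)). Qed.

End Summand.

Definition coprod_map (u : Gamma_coprod X Y sUG sWK sSG) :
    fix_biset (tensor X Y) sUG sWK Ec :=
  exist _ (tens_val (tagged u)) (tens_val_fix (tagged u)).

Lemma coprod_map_morph : biset_morph coprod_map.
Proof.
split=> [g [t A] Cg | [t A] k Ck]; apply: val_inj;
  pose Gt := subsetP sSG _ (valP t).
  rewrite [RHS](val_fix_lact sUG sWK Ec) //= -(treprK A) tens_lact // !tens_valE.
  rewrite (val_fix_lact sUG (Gamma_sub Gt) (Gamma_epil Gt)) // tens_lact //.
  by case/setIP: Cg.
rewrite [RHS](val_fix_ract sUG sWK Ec) //= -(treprK A) tens_ract // !tens_valE.
rewrite (val_fix_ract (Gamma_sub Gt) sWK (Gamma_epir Gt)) // tens_ract //.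
by case/setIP: Ck.
Qed.

Hypothesis trS : is_transversal S [set Gamma_orbit H t | t in Gamma H U c W]
                                (Gamma H U c W).

Lemma Gamma_orbit_refl t : t \in Gamma_orbit H t.
Proof. by apply/imsetP; exists 1; rewrite ?group1 ?Gamma_act1. Qed.

Lemma Gamma_orbitE t : t \in Gamma H U c W ->
  pblock [set Gamma_orbit H t | t in Gamma H U c W] t = Gamma_orbit H t.
Proof.
move=> Gt; have [_ trivP _] := and3P (Gamma_orbit_partition H U W c).
by apply: def_pblock => //; [apply: imset_f | apply: Gamma_orbit_refl].
Qed.

(** An h in H relating the two pairs carries t to t'. Both lie in the transversal S, so they
    coincide, and it remains to see that h lies in C_H(V). *)
Lemma coprod_map_inj : injective coprod_map.
Proof.
move=> [t A] [t' A'] /(congr1 val) /=.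
rewrite -(treprK A) -(treprK A') !tens_valE.
case: (trepr A) (trepr A') => x y [x' y'] /= /tens_eqP[h Hh [x'E y'E]].
pose Gt := subsetP sSG _ (valP t); pose Gt' := subsetP sSG _ (valP t').
have eqt : Gamma_act h (val t) = val t'.
  apply: fix_pairs_inj (Gamma_act_stable Hh Gt) Gt' _ (val_fix_pairs x' y').
  rewrite [val x']x'E [val y']y'E; exact: pair_act_fix Hh Gt (val_fix_pairs x y).
have {eqt A A'} [eqt htE] : t = t' /\ Gamma_act h (val t) = val t.
  suff ett' : t = t' by rewrite -ett' in eqt.
  apply/val_inj/(pblock_inj trS (valP t) (valP t')).
  apply/esym/same_pblock; first by case/and3P: (Gamma_orbit_partition H U W c).
  by rewrite Gamma_orbitE // -eqt; apply: imset_f.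
subst t'; congr Tagged; apply: (proj2 (tens_eqP x y x' y')).
have [_ _ /EpiP[_ bW _] _] := GammaP _ _ _ _ _ Gt.
(* The third component of [htE] says that h commutes with every b w, and these exhaust V. *)
have Ch : h \in 'C_H((val t).1.2).
  rewrite inE Hh; apply/centP=> v; rewrite -bW => /imsetP[w Ww ->].
  have /(congr1 (fun s : tT => s.2 w)) := htE.
  rewrite ffunE => bwE; apply/commute_sym; rewrite -[h]invgK.
  exact/commuteV/commgP/conjg_fixP.
exists h => //.
split; apply: val_inj.
  by rewrite (val_fix_ract sUG (Gamma_sub Gt) (Gamma_epil Gt)) ?groupV.
by rewrite (val_fix_lact (Gamma_sub Gt) sWK (Gamma_epir Gt)).
Qed.

(** Represent the class by a pair, take its triple t, and move both by an h that brings t into S. *)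
Lemma coprod_map_surj v : exists u, coprod_map u = v.
Proof.
case: v => A fA; have [p eA] : exists p, tens p.1 p.2 = A.
  by exists (trepr A); exact: treprK.
have [|t Gt tp] := @fix_pairs_exists p; first by rewrite eA.
have [h Hh hS] : exists2 h, h \in H & Gamma_act h t \in S.
  have /imsetP[s Ss]: pblock [set Gamma_orbit H t | t in Gamma H U c W] t \in
      pblock [set Gamma_orbit H t | t in Gamma H U c W] @: S.
    by rewrite (pblock_transversal trS) Gamma_orbitE // imset_f.
  rewrite !Gamma_orbitE ?(subsetP sSG s) // => eqo.
  have /imsetP[h Hh sE] : s \in Gamma_orbit H t by rewrite eqo Gamma_orbit_refl.
  by exists h; rewrite -?sE.
have := pair_act_fix Hh Gt tp; case/setXP=> fx fy.
pose s : {s : tT | s \in S} := Sub (Gamma_act h t) hS.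
pose x : fixl X sUG (subsetP sSG _ (valP s)) := Sub (ract p.1 h^-1) fx.
pose y : fixr Y sWK (subsetP sSG _ (valP s)) := Sub (lact h p.2) fy.
exists (Gamma_in x y).
by apply: val_inj; rewrite /= tens_valE /= tens_move.
Qed.

Lemma coprod_map_bij : bijective coprod_map.
Proof.
have surj v : exists u, coprod_map u == v.
  by have [u <-] := coprod_map_surj v; exists u.
have gK : cancel (fun v => xchoose (surj v)) coprod_map.
  by move=> v; apply/eqP/(xchooseP (surj v)).
by exists (fun v => xchoose (surj v)) => // u; apply: coprod_map_inj; rewrite gK.
Qed.

End TensorFixedPoints.

Theorem theorem2p3 (gT hT kT : finGroupType)
    (G : {group gT}) (H : {group hT}) (K : {group kT})
    (X : biset G H) (Y : biset H K)
    (freeX : left_free X) (freeY : left_free Y)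
    (U : {group gT}) (W : {group kT})
    (sUG : U \subset G) (sWK : W \subset K)
    (gamma : {ffun kT -> gT}) (Egamma : gamma \in Epi U W)
    (S : {set {ffun hT -> gT} * {group hT} * {ffun kT -> hT}})
    (sSG : S \subset Gamma H U gamma W)
    (trS : is_transversal S [set Gamma_orbit H t | t in Gamma H U gamma W]
                            (Gamma H U gamma W)) :
  (exists f : Gamma_coprod X Y sUG sWK sSG ->
              fix_biset (tensor X Y) sUG sWK Egamma,
     biset_iso f /\
     forall (t : {t | t \in S})
            (x : fixl X sUG (subsetP sSG _ (valP t)))
            (y : fixr Y sWK (subsetP sSG _ (valP t))),
       val (f (Gamma_in x y)) = tens (val x) (val y))
  /\
  (forall Sigma : {set {group hT}},
     is_transversal Sigma (orbit 'JG H @: subgroups H) (subgroups H) ->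
     (#|fixpts (tensor X Y) (tri gamma W)|%:R =
        \sum_(V in subgroups H) #|H|%:R^-1 *
          \sum_(p in epi_pairs U W gamma V)
            #|fixpts X (tri p.1 V)|%:R * #|fixpts Y (tri p.2 W)|%:R
        :> rat)%R /\
     (\sum_(V in subgroups H) #|H|%:R^-1 *
          \sum_(p in epi_pairs U W gamma V)
            #|fixpts X (tri p.1 V)|%:R * #|fixpts Y (tri p.2 W)|%:R =
      \sum_(V in Sigma) #|'N_H(V)|%:R^-1 *
          \sum_(p in epi_pairs U W gamma V)
            #|fixpts X (tri p.1 V)|%:R * #|fixpts Y (tri p.2 W)|%:R
        :> rat)%R).
Proof.
split=> [|Sigma trSigma].
  exists (coprod_map Egamma (sSG := sSG)); split; last first.
    by move=> t x y; exact: tens_valE.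
  by split; [exact: coprod_map_morph | exact: coprod_map_bij].
(* The inner sums are natural numbers; naming them in [nat] lets the counting lemmas apply before
   the cast to [rat]. *)
pose F V := fiber X Y U W gamma V.
have sumE (V : {group hT}) : V \subset H -> (\sum_(p in epi_pairs U W gamma V)
    #|fixpts X (tri p.1 V)|%:R * #|fixpts Y (tri p.2 W)|%:R = (F V)%:R :> rat)%R.
  move=> sVH; rewrite /F (sum_epi_pairs _ _ _ _ _ sVH) natr_sum.
  by apply: eq_bigr => p _; rewrite natrM.
have total : (\sum_(V in subgroups H) #|H|%:R^-1 *
    \sum_(p in epi_pairs U W gamma V)
      #|fixpts X (tri p.1 V)|%:R * #|fixpts Y (tri p.2 W)|%:R =
    \sum_(V in subgroups H) #|H|%:R^-1 * (F V)%:R :> rat)%R.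
  by apply: eq_bigr => V; rewrite inE => sVH; rewrite sumE.
have H0 : (#|H|%:R != 0 :> rat)%R by rewrite pnatr_eq0 -lt0n.
rewrite total; split.
  rewrite -big_distrr -natr_sum sum_fiber // card_fixed_pairs //=.
  by rewrite natrM mulrC mulfK.
rewrite (sum_transversal _ trSigma); apply: eq_bigr => V SV.
have sVH : V \subset H.
  by have := subsetP (transversal_sub trSigma) V SV; rewrite inE.
have [partP _ _] := and3P trSigma; have [_ trivP _] := and3P partP.
rewrite sumE // (def_pblock trivP (B := orbit 'JG H V)) ?orbit_refl //; last first.
  by rewrite imset_f ?inE.
(* The summand is constant on the conjugacy class of V, so only the size of the class matters. *)
rewrite (eq_bigr (fun=> #|H|%:R^-1 * (F V)%:R)%R) => [|_ /imsetP[h Hh ->]]; last first.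
  by rewrite /F fiberJ.
rewrite sumr_const -[LHS]mulr_natr mulrAC; congr (_ * _)%R.
(* The class of V has |H : N_H(V)| members, which turns the factor 1/|H| into 1/|N_H(V)|. *)
have := card_orbit_stab 'JG H V; rewrite astab1JG => <-.
rewrite natrM invfM mulrAC mulVf ?mul1r //.
by rewrite pnatr_eq0 -lt0n; apply/card_gt0P; exists V; apply: orbit_refl.
Qed.
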